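(* Let $\mathcal{A}$ be a unital $C^*$-algebra and $a\in \mathcal{A}$. Then the following statements are equivalent: (i) $v(a)=\frac{\|a\|}{2}$. (ii) $\| Re(\lambda a) \|= \| Im(\lambda a)\|=\frac{\|a\|}{2}$ for all $\lambda\in\mathbb{C}$ with $|\lambda|=1$. (iii) $\| Re(\lambda a) + Im(\lambda a)\|=\| Re(\lambda a) - Im(\lambda a)\|=\frac{\|a\|}{\sqrt{2}}$ for all $\lambda\in\mathbb{C}$ with $|\lambda|=1$. (iv) With $k=\frac12\|a\|$, there is a semi-circular disk $\mathbb{S}_k$ with center at the origin and radius $k$ such that $\mathbb{S}_{k} \subseteq V(a) \subseteq \mathbb{D}_{k}$.
   Context: $\mathcal{A}$ is a unital $C^*$-algebra with unit $e$. $S(\mathcal{A})$ is the set of normalized states, i.e. continuous linear functionals $f$ on $\mathcal{A}$ with $f(e)=\|f\|=1$. The algebraic numerical range of $a$ is $V(a)=\{f(a): f\in S(\mathcal{A})\}\subseteq\mathbb{C}$ and the algebraic numerical radius is $v(a)=\sup\{|f(a)|: f\in S(\mathcal{A})\}$. $Re(a)=\frac12(a+a^* )$ and $Im(a)=\frac{1}{2i}(a-a^* )$. $\mathbb{D}_k=\{z\in\mathbb{C}:|z|\le k\}$ is the circular disk with center at the origin and radius $k$. A semi-circular disk with center at the origin and radius $k$ is a closed half of $\mathbb{D}_k$ cut off by a diameter, i.e. a set $\{z\in\mathbb{C}: |z|\le k,\ \mathrm{Re}(e^{i\theta}z)\ge 0\}$ for some $\theta\in\mathbb{R}$. *)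

(* Defs.v *)
From HB Require Import structures.
From mathcomp Require Import all_boot all_order all_algebra complex.
From mathcomp Require Import all_classical all_reals all_analysis.

Set Implicit Arguments.
Unset Strict Implicit.
Unset Printing Implicit Defensive.

Import Order.TTheory GRing.Theory Num.Theory.
Import numFieldNormedType.Exports.

Local Open Scope classical_set_scope.
Local Open Scope complex_scope.
Local Open Scope ring_scope.

(* The algebra operations are fields here because a structure that inherits
   from both [algType] and [normedModType] is a missing join in the hierarchy
   (a normed ring is taken there to be a [numDomainType]).
   [cstar_one_neq0] excludes the zero algebra, which has no state. *)
HB.mixin Record isCStarAlgebra (R : realType) A
    & CompleteNormedModule R[i] A := {
  cstar_mul : A -> A -> A;
  cstar_one : A;
  adj : A -> A;
  cstar_mulA : associative cstar_mul;
  cstar_mul1l : left_id cstar_one cstar_mul;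
  cstar_mul1r : right_id cstar_one cstar_mul;
  cstar_mulDl : left_distributive cstar_mul +%R;
  cstar_mulDr : right_distributive cstar_mul +%R;
  cstar_mulZl : forall (z : R[i]) (x y : A),
    cstar_mul (z *: x) y = z *: cstar_mul x y;
  cstar_mulZr : forall (z : R[i]) (x y : A),
    cstar_mul x (z *: y) = z *: cstar_mul x y;
  cstar_one_neq0 : cstar_one != 0;
  cstar_normM : forall x y : A, `|cstar_mul x y| <= `|x| * `|y|;
  adjK : involutive adj;
  adjD : {morph adj : x y / x + y};
  adjZ : forall (z : R[i]) (x : A), adj (z *: x) = (z^*)%C *: adj x;
  adjM : forall x y : A, adj (cstar_mul x y) = cstar_mul (adj y) (adj x);
  cstar_identity : forall x : A, `|cstar_mul (adj x) x| = `|x| ^+ 2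
}.

#[short(type="cstarAlgType")]
HB.structure Definition CStarAlgebra (R : realType) :=
  {A of CompleteNormedModule R[i] A & isCStarAlgebra R A}.

(* Norms on spaces over [R[i]] take values in [R[i]]; [rnorm] is the same norm
   with values in [R], where suprema live. *)
Definition rnorm (R : realType) (V : normedZmodType R[i]) (x : V) : R :=
  complex.Re `|x|.

Lemma rnormE (R : realType) (V : normedZmodType R[i]) (x : V) :
  (rnorm x)%:C = `|x|.
Proof. by apply: RRe_real; exact: normr_real. Qed.

Section CStarAlgebra.
Variables (R : realType) (A : cstarAlgType R).
Implicit Types (a : A) (f : {linear A -> R[i]^o}).

(* [sup] is only meaningful on bounded sets, hence on continuous [f] here. *)
Definition functional_norm f : R :=
  sup [set rnorm (f x) | x in [set x : A | rnorm x <= 1]].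

Definition states : set {linear A -> R[i]^o} :=
  [set f : {linear A -> R[i]^o} |
    continuous f /\ f cstar_one = 1 /\ functional_norm f = 1].

Definition numerical_range a : set R[i] := [set (f a : R[i]) | f in states].

Definition numerical_radius a : R := sup [set rnorm (f a) | f in states].

Definition re_part a : A := (2%:R : R[i])^-1 *: (a + adj a).

Definition im_part a : A := (2%:R * 'i%C : R[i])^-1 *: (a - adj a).

End CStarAlgebra.

Section Disks.
Variable R : realType.

Definition disk (k : R) : set R[i] := [set z | rnorm z <= k].

(* [cos theta +i* sin theta] is [e^(i theta)]. *)
Definition semidisk (k theta : R) : set R[i] :=
  [set z | rnorm z <= k /\
           0 <= complex.Re ((cos theta +i* sin theta)%C * z)].

End Disks.

(* Main.v *)
(* All norm estimates take place in the real algebra underlying A and need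
   neither spectral theory nor completeness.  Iterating y := (x + y^2) / 2 from 0
   gives, for |x| <= 1, approximate square roots of 1 - x that are polynomials
   in x.  If h is self-adjoint and |1 + h|, |1 - h| <= 1 + r, then r - h and
   r + h, hence r^2 - h^2, are almost squares, say r^2 - h^2 = w^2, and
   |h|^2 <= |h^2 + w^2| = r^2.  So |1 + h| or |1 - h| equals 1 + |h|, and the
   Hahn-Banach theorem yields a state f with f(h) = |h| or f(h) = -|h|.  The same
   square roots show that a' a is a limit of squares of self-adjoint elements, so
   that states are positive; here and below a' is the adjoint of a.

   (i) => (ii) follows from |Re (lambda a)| <= v(a) and a = Re a + i Im a;
   (ii) => (iii) is the identity Re x + Im x = sqrt 2 Re (e^(-i pi/4) x).
   For (iii) => (iv), V(a) is even the whole disk.  Pick a state f with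
   f(a' a) = |a|^2.  The bounds on Re a and Im a force f(a a') = 0, so that in
   the GNS representation a' kills the cyclic vector xi and a' a xi = |a|^2 xi.
   The vector state of (alpha + t a) xi then takes the value t |a|^2 alpha at a,
   where |alpha|^2 + t^2 |a|^2 = 1, and these values fill the disk. *)
From HB Require Import structures.
Require Import Defs.
From mathcomp Require Import all_boot all_order all_algebra complex ring lra.
From mathcomp Require Import all_classical all_reals all_analysis.

Set Implicit Arguments.
Unset Strict Implicit.
Unset Printing Implicit Defensive.

Import Order.TTheory GRing.Theory Num.Theory.
Import numFieldNormedType.Exports.

Local Open Scope classical_set_scope.
Local Open Scope ring_scope.

(** * The Hahn-Banach theorem for sublinear functionals *)

Section HahnBanach.
Variables (R : realType) (V : lmodType R).
Implicit Types (p q : V -> R) (x y : V) (r t : R).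

(** Homogeneity is asked as an inequality, which passes to infima directly; [sublinearZ] recovers
    equality by applying it to the inverse scalar. *)
Definition sublinear q :=
  (forall x y, q (x + y) <= q x + q y) /\
  (forall r x, 0 <= r -> q (r *: x) <= r * q x).

Lemma sublinearZ q r x : sublinear q -> 0 <= r -> q (r *: x) = r * q x.
Proof.
move=> [qD qZ]; rewrite le0r => /orP[/eqP->|r0].
  rewrite scale0r mul0r; apply/eqP; rewrite eq_le.
  have := qZ 0 0 (lexx _); rewrite scale0r mul0r => -> /=.
  by have := qD 0 0; rewrite addr0 -[leLHS]addr0 lerD2l.
apply/eqP; rewrite eq_le (qZ _ _ (ltW r0)) /= -ler_pdivlMl //.
by rewrite -[in leLHS](scale1r x) -(mulVf (lt0r_neq0 r0)) -scalerA qZ //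
  invr_ge0 ltW.
Qed.

Lemma sublinear_geN q x : sublinear q -> - q (- x) <= q x.
Proof.
move=> qs; have := qs.1 x (- x); rewrite subrr.
have := sublinearZ 0 qs (lexx 0); rewrite scale0r mul0r => ->; lra.
Qed.

(** Serves both the infimum over [t] in [sublinear_lower] and the infimum of a chain in Zorn's
    lemma; the lower bound [b] keeps [inf] away from its default value. *)
Lemma inf_sublinear (I : Type) (D : set I) (g : I -> V -> R) (b : V -> R) :
    D !=set0 -> (forall i x, D i -> b x <= g i x) ->
    (forall i j x y, D i -> D j ->
      exists2 k, D k & g k (x + y) <= g i x + g j y) ->
    (forall i r x, D i -> 0 <= r ->
      exists2 k, D k & g k (r *: x) <= r * g i x) ->
  sublinear (fun x => inf [set g i x | i in D]) /\
  (forall i x, D i -> inf [set g i x | i in D] <= g i x).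
Proof.
move=> [i0 Di0] gb gD gZ.
have lb x : has_lbound [set g i x | i in D].
  by exists (b x) => _ [i Di <-]; exact: gb.
have le i x : D i -> inf [set g i x | i in D] <= g i x.
  by move=> Di; apply: ge_inf => //; exists i.
have inf_ge_g x c :
    (forall i, D i -> c <= g i x) -> c <= inf [set g i x | i in D].
  by move=> cg; apply: lb_le_inf; [exists (g i0 x), i0 | move=> _ [i Di <-];
    exact: cg].
split=> //; split=> [x y|r x].
  rewrite -lerBlDr; apply: (inf_ge_g) => i Di; rewrite lerBlDr -lerBlDl.
  apply: (inf_ge_g) => j Dj; rewrite lerBlDl.
  by have [k Dk kij] := gD i j x y Di Dj; apply: le_trans (le _ _ Dk) kij.
rewrite le0r => /orP[/eqP->|r0].
  have [k Dk] := gZ i0 0 x Di0 (lexx 0); rewrite !mul0r; apply: le_trans;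
    exact: le.
rewrite -ler_pdivrMl //; apply: (inf_ge_g) => i Di; rewrite ler_pdivrMl //.
by have [k Dk] := gZ i r x Di (ltW r0); apply: le_trans; exact: le.
Qed.

(** Take for [q' x] the infimum over [t >= 0] of [q (x + t y) - t q y]: [t = 0] gives [q' <= q], and
    [t = 1] gives the bound at [- y]. *)
Lemma sublinear_lower q y : sublinear q ->
  exists q', [/\ sublinear q', forall x, q' x <= q x & q' (- y) <= - q y].
Proof.
move=> qs; have [qD qZ] := qs.
pose g t x := q (x + t *: y) - t * q y.
have [||||gs gle] := @inf_sublinear R [set t | 0 <= t] g (fun x => - q (- x)).
- by exists 0 => /=.
- move=> t x /= t0; rewrite /g -(sublinearZ _ qs t0).
  have := qD (x + t *: y) (- x); rewrite addrAC subrr add0r; lra.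
- move=> s t x z /= s0 t0; exists (s + t); first exact: addr_ge0.
  rewrite /g scalerDl addrACA; have := qD (x + s *: y) (z + t *: y); lra.
- move=> t r x /= t0 r0; exists (r * t); first exact: mulr_ge0.
  by rewrite /g -scalerA -scalerDr mulrBr mulrA lerD2r; exact: qZ.
exists (fun x => inf [set g t x | t in [set t | 0 <= t]]); split=> // [x|].
  by apply: le_trans (gle 0 x _) _ => //=; rewrite /g scale0r addr0 mul0r subr0.
apply: le_trans (gle 1 _ _) _ => /=; first exact: ler01.
rewrite /g scale1r addNr mul1r.
by have := sublinearZ 0 qs (lexx 0); rewrite scale0r mul0r => ->; rewrite sub0r.
Qed.

(* A sublinear functional that is minimal for the pointwise order is linear. *)
Theorem hahn_banach p x0 : sublinear p ->
  exists phi : {scalar V}, (forall x, phi x <= p x) /\ phi x0 = p x0.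
Proof.
(* A linear [phi] below [p1] has [phi (- x0) <= - p x0], hence [phi x0 >= p x0]. *)
move=> ps; have [p1 [p1s p1p p1x0]] := sublinear_lower x0 ps.
pose ok (q : V -> R) := `[< sublinear q /\ forall x, q x <= p1 x >].
pose T := {q : V -> R | ok q}.
(* The order is reversed, so that the maximal element supplied by Zorn is a minimal functional. *)
pose le (q1 q2 : T) := `[< forall x, sval q2 x <= sval q1 x >].
have [|||F chF|q qmin] := @Zorn T le.
- by move=> q; apply/asboolP.
- by move=> a b c /asboolP ab /asboolP bc; apply/asboolP => x;
  apply: le_trans (bc x) (ab x).
- move=> a b /asboolP ab /asboolP ba; apply/val_inj/funext => x.
  by apply/eqP; rewrite eq_le ab ba.
- have [F0|/set0P F0] := eqVneq F set0.
    have P1 : ok p1 by apply/asboolP.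
    by exists (exist ok _ P1) => s; rewrite F0.
  have Ts (a : T) : sublinear (sval a) /\ forall x, sval a x <= p1 x.
    by apply/asboolP; exact: (svalP a).
  have [||||Fs Fle] :=
    @inf_sublinear T F (fun a => sval a) (fun x => - p1 (- x)).
  + exact: F0.
  + move=> a x _; apply: le_trans (sublinear_geN x (Ts a).1).
    by rewrite lerN2 (Ts a).2.
  + move=> a b x y Fa Fb.
    have [/asboolP ab|/asboolP ba] := chF a b Fa Fb;
      [exists b => //|exists a => //].
      by apply: le_trans ((Ts b).1.1 _ _) _; rewrite lerD2r ab.
    by apply: le_trans ((Ts a).1.1 _ _) _; rewrite lerD2l ba.
  + by move=> a r x Fa r0; exists a => //; exact: (Ts a).1.2.
  have P : ok (fun x => inf [set sval a x | a in F]).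
    apply/asboolP; split=> // x; have [a Fa] := F0.
    by apply: le_trans (Fle a x Fa) ((Ts a).2 x).
  by exists (exist ok _ P) => a Fa; apply/asboolP => x /=; exact: Fle.
have [qs qp1] : sublinear (sval q) /\ forall x, sval q x <= p1 x.
  by apply/asboolP; exact: (svalP q).
(* Minimality forces [q' = q], so [q] is odd; an odd sublinear functional is linear. *)
have qN y : sval q (- y) = - sval q y.
  have [q' [q's q'q q'y]] := sublinear_lower y qs.
  have P : ok q'.
    by apply/asboolP; split=> // x; apply: le_trans (q'q x) (qp1 x).
  have /(congr1 sval) /= q'E := qmin (exist ok q' P) (asboolT q'q).
  apply/eqP; rewrite eq_le -{1}q'E q'y /= lerNl.
  by have := sublinear_geN (- y) qs; rewrite opprK lerNl.
have qlin : GRing.linear_for *%R (sval q).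
  move=> r x y.
  have qD u v : sval q (u + v) = sval q u + sval q v.
    apply/eqP; rewrite eq_le qs.1 /=.
    by have := qs.1 (u + v) (- v); rewrite addrK qN lerBrDr.
  rewrite qD; congr (_ + _); have [r0|r0] := leP 0 r; first exact: sublinearZ.
  rewrite -[r in LHS]opprK scaleNr qN sublinearZ ?oppr_ge0 ?ltW //.
  by rewrite mulNr opprK.
pose m := GRing.isLinear.Build R V R *%R (sval q) qlin.
pose phi : {scalar V} := HB.pack (sval q) m.
exists phi; split=> [x|]; first by apply: le_trans (qp1 x) (p1p x).
apply/eqP; rewrite eq_le; apply/andP; split;
  first exact: le_trans (qp1 x0) (p1p x0).
by rewrite -lerN2 /= -qN; apply: le_trans (qp1 _) p1x0.
Qed.

End HahnBanach.

(** * The underlying real algebra *)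

(* [A] as an [algType R], so that the ring and module lemmas apply to
   [cstar_mul]. *)
Definition realified (R : realType) (A : cstarAlgType R) : Type := A.

Section Realified.
Variables (R : realType) (A : cstarAlgType R).
Local Notation B := (realified A).

HB.instance Definition _ := GRing.Zmodule.on B.

HB.instance Definition _ := GRing.Zmodule_isNzRing.Build B
  (@cstar_mulA R A) (@cstar_mul1l R A) (@cstar_mul1r R A)
  (@cstar_mulDl R A) (@cstar_mulDr R A) (@cstar_one_neq0 R A).

Definition real_scale (r : R) (x : B) : B := r%:C%C *: (x : A).

Fact real_scaleA r s x : real_scale r (real_scale s x) = real_scale (r * s) x.
Proof. by rewrite /real_scale scalerA rmorphM. Qed.

Fact real_scale1 : left_id 1 real_scale.
Proof. by move=> x; rewrite /real_scale rmorph1 scale1r. Qed.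

Fact real_scaleDr : right_distributive real_scale +%R.
Proof. by move=> r x y; rewrite /real_scale scalerDr. Qed.

Fact real_scaleDl x : {morph real_scale^~ x : r s / r + s}.
Proof. by move=> r s; rewrite /real_scale rmorphD scalerDl. Qed.

HB.instance Definition _ := GRing.Zmodule_isLmodule.Build R B
  real_scaleA real_scale1 real_scaleDr real_scaleDl.

Fact real_scaleAl (r : R) (x y : B) : r *: (x * y) = (r *: x) * y.
Proof. by symmetry; exact: cstar_mulZl. Qed.

HB.instance Definition _ := GRing.Lmodule_isLalgebra.Build R B real_scaleAl.

Fact real_scaleAr (r : R) (x y : B) : r *: (x * y) = x * (r *: y).
Proof. by symmetry; exact: cstar_mulZr. Qed.

HB.instance Definition _ := GRing.Lalgebra_isAlgebra.Build R B real_scaleAr.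

Definition nrm (x : B) : R := rnorm (x : A).

Definition star (x : B) : B := adj (x : A).

Fact star_is_linear : linear star.
Proof.
move=> r x y; rewrite /star adjD Defs.adjZ.
by rewrite conjc_real.
Qed.

HB.instance Definition _ := GRing.isLinear.Build R B B *:%R star star_is_linear.

(** In the real algebra [B], complex scalars act through multiplication by this central element. *)
Definition imu : B := 'i%C *: (cstar_one : A).

Implicit Types x y h : B.

Fact nrm_ge0 x : 0 <= nrm x.
Proof. by rewrite -lecR [X in _ <= X]rnormE normr_ge0. Qed.

Fact nrm0 : nrm 0 = 0.
Proof. by rewrite /nrm /rnorm normr0. Qed.

Fact nrmD x y : nrm (x + y) <= nrm x + nrm y.
Proof. by rewrite -lecR rmorphD /= /nrm !rnormE ler_normD. Qed.

Fact nrmN x : nrm (- x) = nrm x.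
Proof. by rewrite /nrm /rnorm normrN. Qed.

Fact nrmB x y : nrm (x - y) <= nrm x + nrm y.
Proof. by rewrite -(nrmN y) nrmD. Qed.

Fact nrm_cscale (z : R[i]) (x : A) : rnorm (z *: x) = rnorm z * rnorm x.
Proof. by apply: complexI; rewrite rmorphM /= !rnormE normrZ. Qed.

Fact rnorm_real (r : R) : rnorm (r%:C)%C = `|r|.
Proof. by rewrite /rnorm normc_def /= expr0n /= addr0 sqrtr_sqr. Qed.

Fact nrmZ (r : R) x : nrm (r *: x) = `|r| * nrm x.
Proof. by rewrite [LHS]nrm_cscale rnorm_real. Qed.

Fact nrmM x y : nrm (x * y) <= nrm x * nrm y.
Proof. by rewrite -lecR rmorphM /= /nrm !rnormE cstar_normM. Qed.

Fact nrm_eq0 x : nrm x = 0 -> x = 0.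
Proof. by move=> x0; apply/(@normr0_eq0 _ A); rewrite -rnormE [rnorm x]x0. Qed.

Fact starM x y : star (x * y) = star y * star x.
Proof. exact: adjM. Qed.

Fact starK x : star (star x) = x.
Proof. exact: adjK. Qed.

Fact star1 : star 1 = 1 :> B.
Proof. by rewrite -[RHS](starK 1) -[in RHS](mulr1 (star 1)) starM starK mulr1.
  Qed.

Fact nrm_starM x : nrm (star x * x) = nrm x ^+ 2.
Proof.
by apply: complexI; rewrite rmorphXn /= /nrm !rnormE; exact: cstar_identity.
Qed.

(** [|y|^2 = |star y y| <= |star y| |y|], applied to [x] and to [star x]. *)
Fact nrm_star x : nrm (star x) = nrm x.
Proof.
have le y : nrm y <= nrm (star y).
  have [->|y0] := eqVneq (nrm y) 0; first exact: nrm_ge0.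
  by rewrite -(@ler_pM2r _ (nrm y)) ?lt0r ?y0 ?nrm_ge0 // -expr2 -nrm_starM
    nrmM.
by apply/eqP; rewrite eq_le le -{2}(starK x) le.
Qed.

Fact nrm1 : nrm 1 = 1.
Proof.
have := nrm_starM 1; rewrite star1 mulr1 => /eqP.
rewrite expr2 -{1}[nrm 1]mulr1 eq_sym -subr_eq0 -mulrBr mulf_eq0 =>
  /orP[/eqP/nrm_eq0/eqP|].
  by rewrite oner_eq0.
by rewrite subr_eq0 => /eqP.
Qed.

Fact nrm_sqr h : star h = h -> nrm (h ^+ 2) = nrm h ^+ 2.
Proof. by move=> hs; rewrite -nrm_starM hs expr2. Qed.

Fact imu_sqr : imu * imu = -1.
Proof.
rewrite [LHS](@cstar_mulZl R A) cstar_mul1l scalerA -expr2 sqr_i.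
by rewrite scaleN1r.
Qed.

Fact imuE x : imu * x = 'i%C *: (x : A).
Proof. by rewrite [LHS](@cstar_mulZl R A) cstar_mul1l. Qed.

Fact imuC x : x * imu = imu * x.
Proof. by rewrite imuE [LHS](@cstar_mulZr R A) cstar_mul1r. Qed.

Fact imuCA x y : x * (imu * y) = imu * (x * y).
Proof. by rewrite mulrA imuC -mulrA. Qed.

Fact star_imu : star imu = - imu.
Proof.
rewrite /star Defs.adjZ -[adj _]/(star 1) star1.
have -> : (('i : R[i])^*)%C = - 'i%C by apply/eqP;
  rewrite eq_complex /= oppr0 !eqxx.
by rewrite scaleNr.
Qed.

Fact nrm_imu x : nrm (imu * x) = nrm x.
Proof.
by rewrite imuE [LHS]nrm_cscale /rnorm normc_def /= expr0n expr1n add0r sqrtr1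
  mul1r.
Qed.

Fact cscaleE (z : R[i]) (x : A) :
  z *: x = (complex.Re z *: (x : B)) + (complex.Im z *: (imu * x)).
Proof.
rewrite imuE.
transitivity ((complex.Re z)%:C%C *: x + (complex.Im z)%:C%C *: ('i%C *: x));
  last by [].
by rewrite scalerA -scalerDl {1}[z]complexE mulrC.
Qed.

End Realified.

(** * Polynomials in one element *)

Section PolynomialCalculus.
Variables (R : realType) (A : cstarAlgType R).
Local Notation B := (realified A).
(** Elements generated by [h] are written as polynomials evaluated at [h], so that [ring] proves
    identities among them in [{poly R}]. *)
Local Notation ev h := (@horner_alg R B h).
Implicit Types (h z : B) (P Q x y : {poly R}) (r e : R).

Fact star_ev h P : star h = h -> star (ev h P) = ev h P.
Proof.
move=> hs; elim/poly_ind: P => [|P c IH]; first by rewrite rmorph0 linear0.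
rewrite rmorphD rmorphM /= horner_algX horner_algC linearD /= starM IH hs.
rewrite linearZ /= star1; congr (_ + _).
by have /= := congr1 (ev h) (mulrC 'X P); rewrite !rmorphM /= horner_algX.
Qed.

Fact nrm_evM h P Q : nrm (ev h (P * Q)) <= nrm (ev h P) * nrm (ev h Q).
Proof. by rewrite rmorphM /= nrmM. Qed.

Fact nrm_evD h P Q : nrm (ev h (P + Q)) <= nrm (ev h P) + nrm (ev h Q).
Proof. by rewrite rmorphD /= nrmD. Qed.

Fact nrm_evB h P Q : nrm (ev h (P - Q)) <= nrm (ev h P) + nrm (ev h Q).
Proof. by rewrite rmorphB /= nrmB. Qed.

Fact nrm_evZ h r P : nrm (ev h (r *: P)) = `|r| * nrm (ev h P).
Proof. by rewrite linearZ /= mulr_algl nrmZ. Qed.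

Fact nrm_evC h r : nrm (ev h r%:P) = `|r|.
Proof. by rewrite horner_algC nrmZ nrm1 mulr1. Qed.

(** The increments of the iteration are dominated by those of the scalar iteration at [x = 1], and
    the error of [(1 - y n)^2] is twice the next increment. *)
Lemma approx_sqrt h x e : nrm (ev h x) <= 1 -> 0 < e ->
  exists y, nrm (ev h y) <= 1 /\
    nrm (ev h ((1 - y) ^+ 2 - (1 - x))) <= e.
Proof.
move=> x1 e0.
pose y := fix y n := if n is n'.+1 then 2^-1 *: (x + y n' ^+ 2) else 0.
(* [d n] is [1 - y n] for the scalar [x = 1]; it is at most [2 / (n + 2)]. *)
pose d := fix d n : R := if n is n'.+1 then d n' - d n' ^+ 2 / 2 else 1.
have yS n : y n.+1 = 2^-1 *: (x + y n ^+ 2) by [].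
have dS n : d n.+1 = d n - d n ^+ 2 / 2 by [].
have d01 n : 0 <= d n <= 1.
  elim: n => [|n IH] /=; first by rewrite ler01 lexx.
  by case/andP: IH => d0 d1; apply/andP; split; nra.
have dE n : d n * n.+2%:R <= 2.
  elim: n => [|n IH]; first by rewrite /= mul1r.
  move: (d01 n) IH => /andP[]; rewrite [d n.+1]/= -[n.+3%:R]natr1 => d0 d1.
  have : (2 : R) <= n.+2%:R by rewrite ler_nat.
  move: n.+2%:R (d n) d0 d1 => N t t0 t1 N2 tN.
  have := sqr_ge0 (t * N - 2); nra.
have yle n : nrm (ev h (y n)) <= 1 - d n.
  elim: n => [|n IH]; first by rewrite /= rmorph0 nrm0 subrr.
  rewrite /= nrm_evZ gtr0_norm ?invr_gt0 // expr2.
  have := nrm_evD h x (y n * y n); have := nrm_evM h (y n) (y n).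
  have := nrm_ge0 (ev h (y n)).
  move: (d01 n) => /andP[d0 d1]; nra.
have dyle n : nrm (ev h (y n.+1 - y n)) <= d n - d n.+1.
  elim: n => [|n IH].
    rewrite /= expr0n /= addr0 subr0 nrm_evZ gtr0_norm ?invr_gt0 //.
    by rewrite expr1n; nra.
  have -> : y n.+2 - y n.+1 = 2^-1 *: ((y n.+1 - y n) * (y n.+1 + y n)).
    rewrite (yS n.+1) {2}(yS n) -scalerBr; congr (_ *: _).
    by move: (y n.+1) (y n) => a b; ring.
  rewrite nrm_evZ gtr0_norm ?invr_gt0 //.
  have -> : d n.+1 - d n.+2 = 2^-1 * ((d n - d n.+1) * (2 - d n - d n.+1)).
    by rewrite (dS n.+1) {2 4}(dS n); move: (d n.+1) (dS n) => ? ->; field.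
  rewrite ler_pM2l ?invr_gt0 //.
  apply: le_trans (nrm_evM _ _ _) _; apply: ler_pM; rewrite ?nrm_ge0 //.
  apply: le_trans (nrm_evD _ _ _) _; have := yle n; have := yle n.+1; lra.
have [n nP] : exists n, 2 * d n ^+ 2 <= e * 2.
  have [n ne] : exists n : nat, 4 / e < n%:R.
    by exists (Num.bound (4 / e)); apply: archi_boundP; rewrite divr_ge0 // ltW.
  exists n; have := dE n; move: (d01 n) => /andP[d0 d1] dn.
  have N0 : 0 < n.+2%:R :> R by rewrite ltr0n.
  have : 4 < e * n.+2%:R.
    rewrite -ltr_pdivrMl // mulrC; apply: lt_le_trans ne _.
    by rewrite ler_nat; do 2 apply: leqW.
  move: dn N0; move: n.+2%:R => N dN N0 eN.
  have : d n ^+ 2 * N <= e * N by nra.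
  by rewrite ler_pM2r //; lra.
exists (y n); split; first by apply: le_trans (yle n) _; move: (d01 n); lra.
have -> : (1 - y n) ^+ 2 - (1 - x) = 2 *: (y n.+1 - y n).
  rewrite yS scalerBr scalerA mulfV ?pnatr_eq0 // scale1r scaler_nat.
  by move: (y n) => a; ring.
rewrite nrm_evZ normr_nat; have := dyle n => /=; lra.
Qed.


(** For [u = P + i Q], [star u u = P^2 + Q^2], and [2 P = u + star u] gives [|P| <= |u|]. *)
Lemma nrm_ev_sumsq h P Q : star h = h ->
  nrm (ev h P) ^+ 2 <= nrm (ev h (P ^+ 2 + Q ^+ 2)).
Proof.
move=> hs; pose u := ev h P + imu A * ev h Q.
have us : star u = ev h P - imu A * ev h Q.
  by rewrite linearD /= starM star_imu !star_ev // mulrN imuC.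
have uu : star u * u = ev h (P ^+ 2 + Q ^+ 2).
  rewrite us rmorphD !rmorphXn /= !mulrDr !mulrBl -!(mulrA (imu A))
    !(imuCA (ev h _)).
  rewrite (mulrA (imu A) (imu A)) imu_sqr mulN1r opprK !expr2.
  have -> : ev h Q * ev h P = ev h P * ev h Q by rewrite -!rmorphM mulrC.
  by rewrite addrA subrK.
rewrite -uu nrm_starM.
have : nrm (2 *: ev h P) <= nrm u + nrm u.
  rewrite -[X in _ + X]nrm_star us; apply: le_trans (nrmD _ _).
  by rewrite /u addrACA subrr addr0 scaler_nat.
rewrite nrmZ normr_nat => Pu; rewrite ler_sqr ?nnegrE ?nrm_ge0 //; lra.
Qed.

(** If [(1 - y)^2] is close to [1 - P^2], then [(1 - y)^2 + P^2] is close to 1, and [nrm_ev_sumsq]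
    bounds [(1 - y)^2]. *)
Lemma nrm_ev_1subsqr h P : star h = h -> nrm (ev h P) <= 1 ->
  nrm (ev h (1 - P ^+ 2)) <= 1.
Proof.
move=> hs P1; apply/ler_addgt0Pr => e e0.
have P2 : nrm (ev h (P ^+ 2)) <= 1.
  by rewrite expr2; apply: le_trans (nrm_evM _ _ _) _;
    rewrite mulr_ile1 ?nrm_ge0.
have e2 : 0 < e / 2 by lra.
have [y [_ ye]] := approx_sqrt P2 e2.
have := nrm_ev_sumsq (1 - y) P hs.
have := nrm_evD h 1 ((1 - y) ^+ 2 - (1 - P ^+ 2)).
have -> : 1 + ((1 - y) ^+ 2 - (1 - P ^+ 2)) = (1 - y) ^+ 2 + P ^+ 2 by ring.
rewrite rmorph1 nrm1 -nrm_sqr ?star_ev // -rmorphXn /=.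
have := nrm_evB h ((1 - y) ^+ 2) ((1 - y) ^+ 2 - (1 - P ^+ 2)).
rewrite opprB addrC subrK; lra.
Qed.

(* [r^2 - h^2 = (r - h) (r + h)] is nearly a square because both factors are. *)
Lemma nrm_le_of_shift h r : star h = h -> 0 <= r ->
  nrm (1 + h) <= 1 + r -> nrm (1 - h) <= 1 + r -> nrm h <= r.
Proof.
move=> hs r0 hD hB.
have r10 : 0 < 1 + r by lra.
have sq4 y : nrm (ev h y) <= 1 -> nrm (ev h ((1 - y) ^+ 2)) <= 4.
  move=> yP; rewrite expr2; apply: le_trans (nrm_evM _ _ _) _.
  have := nrm_evB h 1 y; rewrite rmorph1 nrm1; have := nrm_ge0 (ev h (1 - y)).
  move: (nrm _) (nrm _) yP => t u; nra.
have shrink s : nrm (1 + s *: h) <= 1 + r ->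
    nrm (ev h ((1 + r)^-1 *: (1 + s *: 'X))) <= 1.
  rewrite nrm_evZ rmorphD rmorph1 /= linearZ /= mulr_algl horner_algX.
  by rewrite gtr0_norm ?invr_gt0 // ler_pdivrMl // mulr1.
have x1 : nrm (ev h ((1 + r)^-1 *: (1 + 1 *: 'X))) <= 1.
  by apply: shrink; rewrite scale1r.
have x2 : nrm (ev h ((1 + r)^-1 *: (1 + (-1) *: 'X))) <= 1.
  by apply: shrink; rewrite scaleN1r.
move: x1 x2; set x1 := (X in ev h X); move=> x1P; set x2 := (X in ev h X);
  move=> x2P.
(* The 6 is [4 + 2]: the error [a1] is multiplied by [(1 - y2)^2], of norm at most 4, and [a2] by
   [1 - x1], of norm at most 2. *)
suff le_e e : 0 < e -> nrm h ^+ 2 <= r ^+ 2 + (1 + r) ^+ 2 * (6 * e).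
  rewrite -ler_sqr ?nnegrE ?nrm_ge0 //; apply/ler_addgt0Pr => e e0.
  have c0 : 0 < (1 + r) ^+ 2 * 6 by rewrite mulr_gt0 ?exprn_gt0.
  have := le_e (e / ((1 + r) ^+ 2 * 6)) (divr_gt0 e0 c0).
  by rewrite mulrA mulrCA mulfV ?gt_eqF // mulr1.
move=> e0.
have [y1 [y1P w1P]] := approx_sqrt x1P e0.
have [y2 [y2P w2P]] := approx_sqrt x2P e0.
(* The second square is nearly [(1 + r)^2 (1 - x1) (1 - x2) = r^2 - h^2]. *)
have := nrm_ev_sumsq 'X ((1 + r) *: ((1 - y1) * (1 - y2))) hs.
rewrite horner_algX => /le_trans; apply.
set a1 := (1 - y1) ^+ 2 - (1 - x1) in w1P;
  set a2 := (1 - y2) ^+ 2 - (1 - x2) in w2P.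
have k0 : 1 + r != 0 by rewrite gt_eqF.
have x1E : 1 - x1 = (1 + r)^-1 *: (r%:P - 'X).
  apply: (scalerI k0); rewrite scalerBr !scalerA mulfV // !scale1r scalerDl
    scale1r.
  by rewrite alg_polyC; ring.
have x2E : 1 - x2 = (1 + r)^-1 *: (r%:P + 'X).
  apply: (scalerI k0); rewrite scalerBr !scalerA mulfV // !scale1r scalerDl
    scale1r.
  by rewrite alg_polyC scaleN1r; ring.
have -> : 'X ^+ 2 + ((1 + r) *: ((1 - y1) * (1 - y2))) ^+ 2
    = (r ^+ 2)%:P + (1 + r) ^+ 2 *: (a1 * (1 - y2) ^+ 2 + (1 - x1) * a2).
  have -> : a1 * (1 - y2) ^+ 2 + (1 - x1) * a2
      = (1 - y1) ^+ 2 * (1 - y2) ^+ 2 - (1 - x1) * (1 - x2) by rewrite /a1 /a2;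
        ring.
  have -> : (1 - x1) * (1 - x2) = (1 + r) ^- 2 *: ((r%:P - 'X) * (r%:P + 'X)).
    by rewrite x1E x2E -scalerAl -scalerAr scalerA -exprVn expr2.
  rewrite scalerBr scalerA mulfV ?expf_neq0 // scale1r exprZn rmorphXn /=
    exprMn; ring.
clearbody a1 a2 x1 x2.
apply: le_trans (nrm_evD _ _ _) _; rewrite nrm_evC ger0_norm ?sqr_ge0 // lerD2l.
rewrite nrm_evZ ger0_norm ?sqr_ge0 // ler_pM2l ?exprn_gt0 //.
apply: le_trans (nrm_evD _ _ _) _.
have x11 : nrm (ev h (1 - x1)) <= 2.
  by apply: le_trans (nrm_evB _ _ _) _; rewrite rmorph1 nrm1; lra.
have := nrm_evM h a1 ((1 - y2) ^+ 2); have := nrm_evM h (1 - x1) a2.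
have := sq4 _ y2P; have := nrm_ge0 (ev h ((1 - y2) ^+ 2)).
have := nrm_ge0 (ev h a1); have := nrm_ge0 (ev h a2);
  have := nrm_ge0 (ev h (1 - x1)).
move: (nrm (ev h (1 - x1))) (nrm (ev h a1)) (nrm (ev h a2)) x11 w1P w2P => u v
  w u2 ve we.
move: (nrm _) => t; nra.
Qed.

(** Otherwise the larger of the two norms, minus 1, is an [r < |h|] admissible in [nrm_le_of_shift];
    [r >= 0] because the norms sum to at least 2. *)
Lemma nrm_attained h : star h = h ->
  nrm (1 + h) = 1 + nrm h \/ nrm (1 - h) = 1 + nrm h.
Proof.
move=> hs; have hD := nrmD 1 h; have hB := nrmB 1 h; rewrite nrm1 in hD hB.
have [|D] := ltP (nrm (1 + h)) (1 + nrm h); last by left; lra.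
have [|B'] := ltP (nrm (1 - h)) (1 + nrm h); last by right; lra.
move=> B' D'; have : 2 <= nrm (1 + h) + nrm (1 - h).
  apply: le_trans (nrmD _ _); rewrite addrACA subrr addr0.
  have -> : 1 + 1 = 2 *: 1 :> B by rewrite scaler_nat.
  by rewrite nrmZ nrm1 normr_nat mulr1.
have [le|le] := leP (nrm (1 + h)) (nrm (1 - h)) => sum2.
- have := @nrm_le_of_shift h (nrm (1 - h) - 1) hs; rewrite subrKC => H.
  by have := H _ le (lexx _); lra.
- have := @nrm_le_of_shift h (nrm (1 + h) - 1) hs; rewrite subrKC => H.
  by have := H _ (lexx _) (ltW le); lra.
Qed.

(** A rescaling of [nrm_ev_1subsqr] by the square root of [t]; applied under a state it makes
    squares positive. *)
Lemma nrm_sub_sqr z (t : R) : star z = z -> 0 < t -> nrm (z ^+ 2) <= t ->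
  nrm (t *: 1 - z ^+ 2) <= t.
Proof.
move=> zs t0 zt.
have st : (Num.sqrt t) ^+ 2 = t by rewrite sqr_sqrtr // ltW.
have s0 : Num.sqrt t != 0 by rewrite sqrtr_eq0 -ltNge.
have := @nrm_ev_1subsqr z ((Num.sqrt t)^-1 *: 'X) zs.
rewrite exprZn exprVn st nrm_evZ horner_algX rmorphB rmorph1 /= linearZ /=
  mulr_algl.
rewrite rmorphXn /= horner_algX => H.
have -> : t *: 1 - z ^+ 2 = t *: (1 - t^-1 *: z ^+ 2).
  by rewrite scalerBr scalerA mulfV ?scale1r // gt_eqF.
rewrite nrmZ gtr0_norm // -[leRHS]mulr1 ler_pM2l //; apply: H.
rewrite normfV ger0_norm ?sqrtr_ge0 // ler_pdivrMl ?lt0r ?s0 ?sqrtr_ge0 //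
  mulr1.
by rewrite -ler_sqr ?nnegrE ?nrm_ge0 ?sqrtr_ge0 // st -nrm_sqr.
Qed.


End PolynomialCalculus.

(** * Real parts of states *)

Section RealStates.
Variables (R : realType) (A : cstarAlgType R).
Local Notation B := (realified A).
Local Notation ev h := (@horner_alg R B h).
Local Notation imu := (imu A).
Implicit Types (phi : {scalar B}) (x y z h : B) (r t e : R).

(* A complex functional is determined by its real part, see [complexify]; the
   condition [functional_norm f = 1] reduces to this one-sided bound. *)
Definition real_state phi := (forall x, phi x <= nrm x) /\ phi 1 = 1.

Lemma nrm_sublinear : sublinear (@nrm R A).
Proof. by split=> [|r x r0]; [exact: nrmD | rewrite nrmZ ger0_norm]. Qed.

Fact real_state_scalar phi t : real_state phi -> phi (t *: 1) = t.
Proof. by move=> [_ phi1]; rewrite linearZ /= phi1 mulr1. Qed.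

Lemma real_state_abs phi x : real_state phi -> `|phi x| <= nrm x.
Proof.
move=> [phile _]; rewrite ler_norml phile andbT lerNl -linearN.
by rewrite -(nrmN x).
Qed.

(** A functional norming [1 + h] or [1 - h], where the norm is [1 + |h|], must attain its bound at
    both summands. *)
Lemma real_state_norming h : star h = h ->
  exists2 phi, real_state phi & phi h = nrm h \/ phi h = - nrm h.
Proof.
move=> hs; have [n1|n1] := nrm_attained hs.
- have [phi [phile phi1]] := hahn_banach (1 + h) nrm_sublinear.
  have := phile 1; have := phile h; move: phi1;
    rewrite linearD /= n1 nrm1 => e p1 p2.
  by exists phi; [split => //; lra | left; lra].
- have [phi [phile phi1]] := hahn_banach (1 - h) nrm_sublinear.
  have := phile 1; have := phile (- h); move: phi1.
  rewrite linearB /= linearN /= nrmN n1 nrm1 => e p1 p2.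
  by exists phi; [split => //; lra | right; lra].
Qed.

(** From [|t + i h|^2 = |t^2 + h^2| <= t^2 + |h|^2] follows [2 t c + c^2 <= |h|^2] for every [t],
    which is impossible unless [c = 0]. *)
Lemma real_state_imu phi h : real_state phi -> star h = h -> phi (imu * h) = 0.
Proof.
move=> phis hs; set c := phi _.
suff le t : 2 * t * c + c ^+ 2 <= nrm h ^+ 2.
  apply/eqP; apply: contraT => c0.
  have := le ((nrm h ^+ 2 + 1) / (2 * c)).
  have -> : 2 * ((nrm h ^+ 2 + 1) / (2 * c)) * c = nrm h ^+ 2 + 1 by field.
  have := sqr_ge0 c; lra.
have := real_state_abs (t *: 1 + imu * h) phis.
rewrite linearD /= real_state_scalar // -/c.
rewrite -ler_sqr ?nnegrE ?nrm_ge0 // real_normK ?num_real // -(nrm_starM (t *: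
  1 + imu * h)).
have -> : star (t *: 1 + imu * h) * (t *: 1 + imu * h) = t ^+ 2 *: 1 + h ^+ 2.
  rewrite linearD /= linearZ /= star1 starM star_imu hs mulrN imuC.
  rewrite !mulrDr !mulrBl -!(mulrA imu) (imuCA h) (mulrA imu imu) imu_sqr
    mulN1r opprK.
  rewrite -!scalerAl -!scalerAr !mul1r mulr1 scalerA -!expr2 addrA.
  by rewrite subrK.
move=> /le_trans /(_ (nrmD _ _)); rewrite nrmZ nrm1 mulr1 ger0_norm ?sqr_ge0 //.
by rewrite nrm_sqr //; nra.
Qed.

Lemma star_imuB x : star (imu * (x - star x)) = imu * (x - star x).
Proof. by rewrite starM star_imu linearB /= starK mulrN -mulNr opprB imuC. Qed.

Lemma real_state_star phi x : real_state phi -> phi (star x) = phi x.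
Proof.
move=> phis; apply/eqP; rewrite -subr_eq0 -linearB /=.
have -> : star x - x = imu * (imu * (x - star x)).
  by rewrite mulrA imu_sqr mulN1r opprB.
by rewrite real_state_imu // star_imuB.
Qed.

Lemma real_state_sqr_ge0 phi h :
  real_state phi -> star h = h -> 0 <= phi (h ^+ 2).
Proof.
move=> phis hs; have t0 : 0 < nrm (h ^+ 2) + 1 by have := nrm_ge0 (h ^+ 2); lra.
have /(_ _) := nrm_sub_sqr hs t0;
  have := phis.1 ((nrm (h ^+ 2) + 1) *: 1 - h ^+ 2).
by rewrite linearB /= real_state_scalar //; lra.
Qed.

(** The variance [phi ((h - c)^2)] is nonnegative. *)
Lemma real_state_sqr_ge phi h : real_state phi -> star h = h ->
  phi h ^+ 2 <= phi (h ^+ 2).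
Proof.
move=> phis hs; set c := phi h.
have := @real_state_sqr_ge0 phi (h - c *: 1) phis.
rewrite linearB /= linearZ /= star1 hs => /(_ erefl).
have -> : (h - c *: 1) ^+ 2 = h ^+ 2 - (2 * c) *: h + c ^+ 2 *: 1.
  rewrite expr2 mulrBr !mulrBl -!scalerAl -!scalerAr !mul1r !mulr1 scalerA
    -!expr2.
  have -> : (2 * c) *: h = c *: h + c *: h by rewrite mulr_natl mulr2n scalerDl.
  by rewrite opprB opprD !addrA addrAC.
rewrite linearD linearB /= !linearZ /= phis.2 -/c -[_ *: - c]/(2 * c * - c);
  nra.
Qed.

Lemma imuM_sqr x : (imu * x) ^+ 2 = - x ^+ 2.
Proof. by rewrite !expr2 -mulrA (imuCA x) mulrA imu_sqr mulN1r. Qed.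

Lemma star_sqrD x :
  (x + star x) ^+ 2 + (imu * (x - star x)) ^+ 2
    = 2 *: (x * star x + star x * x).
Proof.
rewrite imuM_sqr !expr2 mulrDl mulrBl !mulrDr !mulrN scaler_nat mulr2n.
move: (x * x) (x * star x) (star x * x) (star x * star x) => s t u v.
rewrite !opprB (addrC (u - v)) [LHS]addrACA (addrC s t) (addrACA t s) (addrACA
  u v).
by rewrite !subrr !addr0 addrACA.
Qed.

(** * Approximating [star a * a] by squares of self-adjoint elements *)

Section Positivity.
Variable a : B.
Local Notation p := (star a * a).

Let star_p : star p = p. Proof. by rewrite starM starK. Qed.

(* With [q = |p| - p], [c = a q] satisfies [c^* c = - |p| q^2], while
   [c c^* + c^* c] is a sum of two squares: hence [c c^*] is also positive, and
   comparing the norms of [t + t^2] at [t = c^* c] and [t = c c^*] gives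
   [c = 0]. *)
Lemma star_mul_approx_sqr_le1 e : nrm a <= 1 -> 0 < e ->
  exists2 n, star n = n & nrm (p - n ^+ 2) <= e.
Proof.
move=> a1; wlog e1 : e / e <= 1 => [hw e0|e0].
  have [le1|le1] := leP e 1; first exact: hw.
  by have [n ns nP] := hw 1 (lexx _) ltr01; exists n => //;
    apply: le_trans nP (ltW le1).
have p1 : nrm (ev p 'X) <= 1.
  by rewrite horner_algX nrm_starM; have := nrm_ge0 a; nra.
(* The error in [q] will be the fourth root of [81 d], that is [3 f]; with [d <= f] the total is
   [4 f = e]. *)
pose f := e / 4; have f0 : 0 < f by rewrite /f; lra.
have f1 : f <= 1 / 4 by rewrite /f; lra.
pose d := f ^+ 4; have d0 : 0 < d by rewrite exprn_gt0.
(* [m] approximates the absolute value of [p], as [m^2] is close to [p^2], and [n] approximates a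
   square root of [m]. *)
have [y [y1 yP]] := approx_sqrt (nrm_ev_1subsqr star_p p1) d0.
have [z [z1 zP]] := approx_sqrt y1 d0.
move: yP zP; set m := 1 - y; set n := 1 - z; rewrite subKr => yP zP.
pose q := m - 'X.
have m2 : nrm (ev p m) <= 2.
  by rewrite /m; have := nrm_evB p 1 y; rewrite rmorph1 nrm1; lra.
have q3 : nrm (ev p q) <= 3 by rewrite /q; have := nrm_evB p m 'X; lra.
pose c := a * ev p q.
have evs P : star (ev p P) = ev p P by rewrite star_ev.
have cc : star c * c = ev p (q * 'X * q).
  by rewrite /c starM evs !rmorphM /= horner_algX !mulrA.
pose v := q * n.
(* If [m^2 = p^2] and [n^2 = m] were exact, [q (m + p) = 0] would give [q^2 p = - q^2 m = - v^2].
   With [|q| <= 3] the errors add up to [9 d + 3 d]. *)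
have ccv : nrm (star c * c + (ev p v) ^+ 2) <= 12 * d.
  rewrite cc -rmorphXn -rmorphD /=.
  have -> : q * 'X * q + v ^+ 2
      = q * (q * (n ^+ 2 - m)) + q * (m ^+ 2 - 'X ^+ 2).
    by rewrite /v /q; ring.
  have h1 := nrm_evM p q (q * (n ^+ 2 - m));
    have h2 := nrm_evM p q (n ^+ 2 - m).
  have h3 := nrm_evM p q (m ^+ 2 - 'X ^+ 2).
  apply: le_trans (nrm_evD _ _ _) _.
  have := nrm_ge0 (ev p q); have := nrm_ge0 (ev p (n ^+ 2 - m)).
  have := nrm_ge0 (ev p (m ^+ 2 - 'X ^+ 2)).
  have := nrm_ge0 (ev p (q * (n ^+ 2 - m))).
  move: h1 h2 h3 q3 yP zP.
  move: (nrm (ev p (q * (q * _)))) (nrm (ev p (q * (n ^+ 2 - m))))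
    (nrm (ev p (q * _))).
  move: (nrm (ev p q)) (nrm (ev p (n ^+ 2 - m)))
    (nrm (ev p (m ^+ 2 - 'X ^+ 2))) (d).
  by move=> q' u w d' r s t; nra.
pose k := nrm c ^+ 2; pose eta := 12 * d.
have eta0 : 0 < eta by rewrite /eta; lra.
have k0 : 0 <= k by exact: sqr_ge0.
have kle : k <= eta.
  have cck : nrm (star c * c) = k by exact: nrm_starM.
  pose t := c * star c.
  have ts : star t = t by rewrite starM starK.
  have tk : nrm t = k by rewrite /t -{1}[c]starK nrm_starM nrm_star.
  have vs : star (ev p v) = ev p v by [].
  have v2 : nrm (ev p v ^+ 2) <= k + eta.
    have := nrmB (star c * c + ev p v ^+ 2) (star c * c).
    by rewrite addrAC subrr add0r /eta; lra.
  have T0 : 0 < k + eta by lra.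
  have kcc : nrm ((k + eta) *: 1 + star c * c) <= k + eta + eta.
    have := nrm_sub_sqr vs T0 v2.
    have := nrmD ((k + eta) *: 1 - ev p v ^+ 2) (star c * c + ev p v ^+ 2).
    by rewrite addrACA addNr addr0 /eta; lra.
  (* Sandwiching the element of [kcc] between [c] and [star c] gives a quadratic expression in
     [t]. *)
  have tt : nrm ((k + eta) *: t + t ^+ 2) <= k * (k + eta + eta).
    have -> : (k + eta) *: t + t ^+ 2
        = c * (((k + eta) *: 1 + star c * c) * star c).
      by rewrite mulrDl mulrDr -scalerAl mul1r -scalerAr expr2 /t !mulrA.
    apply: le_trans (nrmM _ _) _.
    have -> : k * (k + eta + eta) = nrm c * (nrm c * (k + eta + eta)).
      by rewrite mulrA -expr2.
    rewrite ler_wpM2l ?nrm_ge0 //.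
    apply: le_trans (nrmM _ _) _.
    by rewrite nrm_star mulrC ler_wpM2l ?nrm_ge0.
  (* If [g t = k], then [g (t^2) >= k^2] gives [(k + eta) k + k^2 <= k (k + 2 eta)]; if [g t = - k],
     [gtge] applies. Either way [k <= eta]. *)
  have [g gs gt] := real_state_norming ts.
  have gtge : - eta <= g t.
    have sq x : star x = x -> 0 <= g (x ^+ 2) by exact: real_state_sqr_ge0.
    have h1 : 0 <= g (2 *: (t + star c * c)).
      rewrite -star_sqrD linearD addr_ge0 ?sq ?star_imuB //.
      by rewrite linearD /= starK addrC.
    have := sq _ vs; have := gs.1 (star c * c + ev p v ^+ 2).
    by move: h1; rewrite linearZ /= !linearD /=; rewrite /eta; lra.
  have := real_state_sqr_ge gs ts.
  have := gs.1 ((k + eta) *: t + t ^+ 2); rewrite linearD linearZ /=.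
  move: gt gtge; rewrite tk; move: (g t) (g _) => u w [->|->]; nra.
(* [q^3 = q (m^2 - 'X^2) - 2 q 'X q], with terms of norm at most [3 d] and [2 k <= 24 d]; one more
   factor [|q| <= 3] gives [81 d]. *)
have q81 : nrm (ev p q) ^+ 4 <= 81 * d.
  have -> : nrm (ev p q) ^+ 4 = nrm (ev p (q ^+ 4)).
    by rewrite rmorphXn /= !(exprM _ 2 2) !nrm_sqr // -rmorphXn evs.
  have -> : q ^+ 4 = q * (q * (m ^+ 2 - 'X ^+ 2) - 2 *: (q * 'X * q)).
    by rewrite scaler_nat /q; ring.
  apply: le_trans (nrm_evM _ _ _) _.
  have := nrm_evB p (q * (m ^+ 2 - 'X ^+ 2)) (2 *: (q * 'X * q)).
  have := nrm_evM p q (m ^+ 2 - 'X ^+ 2).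
  rewrite nrm_evZ normr_nat -cc nrm_starM -/k.
  have := nrm_ge0 (ev p q); have := nrm_ge0 (ev p (m ^+ 2 - 'X ^+ 2)).
  move: kle; rewrite /eta; move: q3 yP; clearbody k d.
  move: (nrm (ev p (m ^+ 2 - 'X ^+ 2))) (nrm (ev p (q * _)))
    (nrm (ev p (_ - _))) (nrm (ev p q)).
  move=> r s t u u3 rd kd r0 u0 sur tsk.
  have s3 : s <= 3 * d by nra.
  have t27 : t <= 27 * d by lra.
  by nra.
have qf : nrm (ev p q) <= 3 * f.
  have f3 : 0 <= 3 * f by lra.
  rewrite -(@ler_pXn2r _ 4 isT) ?nnegrE ?nrm_ge0 //.
  by apply: le_trans q81 _; rewrite exprMn -natrX.
exists (ev p n) => //;
  rewrite -[X in nrm (X - _)](horner_algX p) -rmorphXn -rmorphB.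
have -> : 'X - n ^+ 2 = - q - (n ^+ 2 - m) by rewrite /q; ring.
apply: le_trans (nrm_evB _ _ _) _; rewrite rmorphN nrmN.
have : d <= f.
  by rewrite /d exprS ler_piMr ?(ltW f0) // exprn_ile1 ?(ltW f0) //; lra.
by move: zP qf; rewrite /f; lra.
Qed.

End Positivity.

Lemma star_mul_approx_sqr (a : B) e : 0 < e ->
  exists2 n, star n = n & nrm (star a * a - n ^+ 2) <= e.
Proof.
move=> e0; pose s := nrm a + 1; have s0 : 0 < s by have := nrm_ge0 a;
  rewrite /s; lra.
have s1 : s != 0 by rewrite gt_eqF.
have b1 : nrm (s^-1 *: a) <= 1.
  by rewrite nrmZ gtr0_norm ?invr_gt0 // ler_pdivrMl // mulr1 /s; lra.
have es : 0 < e / s ^+ 2 by rewrite divr_gt0 // exprn_gt0.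
have [n ns nP] := star_mul_approx_sqr_le1 b1 es.
exists (s *: n); first by rewrite linearZ /= ns.
have -> : star a * a - (s *: n) ^+ 2
    = s ^+ 2 *: (star (s^-1 *: a) * (s^-1 *: a) - n ^+ 2).
  rewrite scalerBr exprZn [star (_ *: _)]linearZ /= -scalerAl -scalerAr
    !scalerA.
  by rewrite -mulrA -expr2 exprVn mulfV ?expf_neq0 // scale1r.
by rewrite nrmZ ger0_norm ?sqr_ge0 // mulrC -ler_pdivlMr // exprn_gt0.
Qed.

Lemma real_state_ge0 phi x : real_state phi -> 0 <= phi (star x * x).
Proof.
move=> phis; rewrite -oppr_le0; apply/ler_addgt0Pr => e e0; rewrite add0r.
have [n ns nP] := star_mul_approx_sqr x e0.
have := real_state_sqr_ge0 phis ns.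
have := phis.1 (- (star x * x - n ^+ 2)); rewrite nrmN linearN /= linearB /=;
  lra.
Qed.

(** An approximate square root [w] of [1 - h / |h|] makes [|h| - h] close to [|h| w^2], and
    [phi (star (w x) (w x)) >= 0]. *)
Lemma real_state_compress phi x h : real_state phi -> star h = h ->
  phi (star x * h * x) <= nrm h * phi (star x * x).
Proof.
move=> phis hs; have [/nrm_eq0->|h0] := eqVneq (nrm h) 0.
  by rewrite mulr0 mul0r linear0 nrm0 mul0r.
have hp : 0 < nrm h by rewrite lt0r h0 nrm_ge0.
have h1 : nrm (ev h ((nrm h)^-1 *: 'X)) <= 1.
  by rewrite nrm_evZ horner_algX gtr0_norm ?invr_gt0 // mulVf.
rewrite -subr_le0; apply/ler_addgt0Pr => e e0; rewrite add0r.
pose s := nrm h * nrm x ^+ 2 + 1.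
have s0 : 0 < s by rewrite /s ltr_wpDl // mulr_ge0 ?sqr_ge0 // nrm_ge0.
have [y [_ yP]] := approx_sqrt h1 (divr_gt0 e0 s0).
pose w := ev h (1 - y).
have ws : star w = w by rewrite star_ev.
pose r := ev h ((1 - y) ^+ 2 - (1 - (nrm h)^-1 *: 'X)).
have E : nrm h *: (star (w * x) * (w * x) - star x * r * x)
    = nrm h *: (star x * x) - star x * h * x.
  rewrite starM ws mulrA -(mulrA _ w w) -mulrBl -mulrBr.
  have -> : w * w - r = 1 - (nrm h)^-1 *: h.
    rewrite /w /r -expr2 -rmorphXn -rmorphB /= subKr rmorphB rmorph1 /= linearZ
      /=.
    by rewrite mulr_algl horner_algX.
  rewrite mulrBr mulr1 mulrBl scalerBr -!scalerAr -!scalerAl scalerA.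
  by rewrite mulfV // scale1r.
have := congr1 phi E; rewrite linearZ /= !linearB /= linearZ /= => E'.
have pos : 0 <= nrm h * phi (star (w * x) * (w * x)).
  by rewrite mulr_ge0 ?nrm_ge0 // real_state_ge0.
have : phi (star x * r * x) <= nrm x ^+ 2 * (e / s).
  apply: le_trans (phis.1 _) _; apply: le_trans (nrmM _ _) _.
  have -> : nrm x ^+ 2 * (e / s) = nrm x * (e / s) * nrm x by ring.
  rewrite ler_wpM2r ?nrm_ge0 //.
  apply: le_trans (nrmM _ _) _.
  by rewrite nrm_star ler_wpM2l ?nrm_ge0.
rewrite -(ler_pM2l hp) => le1.
have : nrm h * (nrm x ^+ 2 * (e / s)) <= e.
  rewrite mulrA mulrCA ler_piMr ?(ltW e0) // ler_pdivrMr // mul1r /s; lra.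
lra.
Qed.

(** Cauchy-Schwarz for a null vector: [t^2 u - 2 t c] is nonnegative for all [t], yet negative at
    [t = c / (u + 1)] if [c] is nonzero. *)
Lemma real_state_null phi x y : real_state phi ->
  phi (star y * y) = 0 -> phi (star x * y) = 0.
Proof.
move=> phis y0; set c := phi _.
have yx : phi (star y * x) = c.
  by rewrite -(real_state_star _ phis) starM starK.
pose u := phi (star x * x); have u0 : 0 <= u by exact: real_state_ge0.
have le t : 0 <= t ^+ 2 * u - 2 * t * c.
  have <- : phi (star (t *: x - y) * (t *: x - y)) = t ^+ 2 * u - 2 * t * c.
    rewrite [star _]linearB /= [star (_ *: _)]linearZ /= mulrBr !mulrBl.
    rewrite -!(@scalerAl _ B) -!(@scalerAr _ B) scalerA !(raddfB phi) /=
      !(scalarZ phi).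
    by rewrite yx y0 -/c -/u; ring.
  exact: real_state_ge0.
apply/eqP; apply: contraT => c0.
have := le (c / (u + 1)).
have u1 : u + 1 != 0 by rewrite gt_eqF //; lra.
have -> : (c / (u + 1)) ^+ 2 * u - 2 * (c / (u + 1)) * c
   = - (c ^+ 2 * (u + 2) / (u + 1) ^+ 2) by field.
rewrite oppr_ge0 leNgt => /negP; case.
have c2 : 0 < c ^+ 2 by rewrite exprn_even_gt0.
by apply: divr_gt0; [apply: mulr_gt0 | apply: exprn_gt0]; lra.
Qed.
End RealStates.

(** * States *)

(* [e^(- i pi / 4)] *)
Definition phase (R : realType) : R[i] :=
  ((Num.sqrt 2)^-1 -i* (Num.sqrt 2)^-1)%C.

Section States.
Variables (R : realType) (A : cstarAlgType R).
Local Notation B := (realified A).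
Implicit Types (f : {linear A -> R[i]^o}) (phi : {scalar B}) (x : A).

Fact rnormM (z w : R[i]) : rnorm (z * w) = rnorm z * rnorm w.
Proof. by apply: complexI; rewrite rmorphM /= !rnormE normrM. Qed.

Fact rnorm_ge0 (V : normedZmodType R[i]) (v : V) : 0 <= rnorm v.
Proof. by rewrite -lecR rnormE normr_ge0. Qed.

Fact Re_le_rnorm (z : R[i]) : complex.Re z <= rnorm z.
Proof.
rewrite /rnorm normc_def /=; apply: le_trans (ler_norm _) _.
by rewrite -sqrtr_sqr ler_wsqrtr // lerDl sqr_ge0.
Qed.

Fact rnorm_unit (z : R[i]) : `|z| = 1 -> rnorm z = 1.
Proof. by rewrite /rnorm => ->. Qed.

Fact rnorm_le_rotate (z : R[i]) c :
  (forall w, rnorm w = 1 -> complex.Re (w * z) <= c) -> rnorm z <= c.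
Proof.
move=> H; have [z0|z0] := eqVneq z 0.
  have := H 1; rewrite z0 /rnorm normr0 normr1 mulr0 /=; exact.
have n0 : `|z| != 0 by rewrite normr_eq0.
have := H (`|z| / z); rewrite divfK // => -> //.
by rewrite /rnorm normrM normr_id normfV mulfV.
Qed.

(** Continuity bounds [f] on the unit ball, so [functional_norm f] is a true supremum; the estimate
    then scales from the ball. *)
Lemma state_bound f x : states f -> rnorm (f x) <= rnorm x.
Proof.
move=> [fc [_ fn]].
have [c c0 fb] : exists2 c : R[i], 0 < c & forall y, `|f y| <= c * `|y|.
  by have /linear_bounded_continuous/linear_boundedP/pinfty_ex_gt0[c c0 cP] :=
    fc; exists c.
have ub : has_ubound [set rnorm (f y) | y in [set y : A | rnorm y <= 1]].
  exists (complex.Re c) => _ [y /= y1 <-].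
  rewrite -lecR rnormE RRe_real ?gtr0_real //; apply: le_trans (fb y) _.
  by rewrite -[leRHS]mulr1 ler_wpM2l ?(ltW c0) // -rnormE lecR.
have [x0|x0] := eqVneq (rnorm x) 0.
  have : `|f x| <= 0 by apply: le_trans (fb x) _; rewrite -rnormE x0 mulr0.
  by rewrite x0 -lecR rnormE.
have xp : 0 < rnorm x by rewrite lt0r x0 rnorm_ge0.
have : rnorm (f (((rnorm x)^-1)%:C%C *: x)) <= 1.
  rewrite -[leRHS]fn; apply: ub_le_sup ub _ _;
    exists (((rnorm x)^-1)%:C%C *: x) => //=.
  by rewrite nrm_cscale rnorm_real gtr0_norm ?invr_gt0 // mulVf.
by rewrite linearZ /= rnormM rnorm_real gtr0_norm ?invr_gt0 // ler_pdivrMl //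
  mulr1.
Qed.

Lemma state_intro f :
  f cstar_one = 1 -> (forall x, rnorm (f x) <= rnorm x) -> states f.
Proof.
move=> f1 fb; split; [|split=> //].
  apply/linear_bounded_continuous/linear_boundedP.
  by exists 1; split=> // M M1 y; apply: le_trans (ler_wpM2r _ (ltW M1)) => //;
    rewrite mul1r -!rnormE lecR.
have one : rnorm (f cstar_one) = 1 by rewrite f1 /rnorm normr1.
have n1 : rnorm (cstar_one : A) = 1 by exact: nrm1.
apply/eqP; rewrite eq_le; apply/andP; split.
  apply: ge_sup; first by exists 1, cstar_one => //=; rewrite n1.
  by move=> _ [y /= y1 <-]; apply: le_trans (fb y) y1.
apply: ub_le_sup; last by exists cstar_one => //=; rewrite n1.
by exists 1 => _ [y /= y1 <-]; apply: le_trans (fb y) y1.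
Qed.

(** The complex-linear functional with real part [phi], since [Re (f (i x)) = - Im (f x)]. *)
Definition complexify phi (x : A) : R[i] :=
  (phi (x : B) -i* phi (imu A * (x : B)))%C.

Lemma real_state_of_state f : states f ->
  exists2 phi, real_state phi & forall x, f x = complexify phi x.
Proof.
move=> fs; have lin : GRing.linear_for *%R (fun x : B => complex.Re (f x)).
  move=> r x y; rewrite linearD /= raddfD /=; congr (_ + _).
  have -> : f (r *: x) = (r%:C)%C * f x.
    by rewrite -[LHS]/(f ((r%:C)%C *: (x : A))) linearZ.
  by case: (f x) => u v /=; rewrite mul0r subr0.
pose m := GRing.isLinear.Build R B R *%R _ lin.
pose phi : {scalar B} := HB.pack (fun x : B => complex.Re (f x)) m.
exists phi.
  split=> [x|]; first by apply: le_trans (Re_le_rnorm _) (state_bound _ fs).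
  by rewrite /phi /= [f _]fs.2.1.
move=> x; rewrite /complexify /phi /= imuE linearZ /=.
by case: (f x) => u v; rewrite /= mul0r mul1r sub0r opprK.
Qed.

Lemma state_of_real_state phi : real_state phi ->
  exists2 f, states f & forall x, f x = complexify phi x.
Proof.
move=> phis.
have lin : linear (complexify phi : A -> R[i]^o).
  move=> z x y; rewrite /complexify cscaleE !mulrDr -!scalerAr !linearD /=
    !linearZ /=.
  rewrite (mulrA (imu A)) imu_sqr mulN1r linearN /=.
  case: z => u v; rewrite /GRing.scale /=.
  by apply/eqP; rewrite eq_complex /=; apply/andP; split; apply/eqP; ring.
pose m := GRing.isLinear.Build R[i] A R[i]^o *:%R _ lin.
pose f : {linear A -> R[i]^o} := HB.pack (complexify phi : A -> R[i]^o) m.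
exists f => //; apply: state_intro => [|x].
  rewrite /f /= /complexify phis.2.
  by rewrite real_state_imu // ?oppr0 // star1.
(* The one-sided bound on [phi] at all rotations of [x] bounds the modulus. *)
apply: rnorm_le_rotate => w w1.
have -> : complex.Re (w * f x) = phi (w *: x : B).
  by rewrite -[LHS]/(complex.Re (w *: f x)) -linearZ.
by apply: le_trans (phis.1 _) _; rewrite [nrm _]nrm_cscale w1 mul1r.
Qed.

Lemma numerical_radius_ub (a : A) f :
  states f -> rnorm (f a) <= numerical_radius a.
Proof.
move=> fs; apply: ub_le_sup; last by exists f.
by exists (rnorm a) => _ [g gs <-]; exact: state_bound.
Qed.

(** * Real and imaginary parts under rotation *)

Lemma re_partE x : re_part x = 2^-1 *: ((x : B) + star x).
Proof.
rewrite /re_part; have -> : (2%:R : R[i])^-1 = (2^-1)%:C%C.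
  by rewrite fmorphV rmorph_nat.
by [].
Qed.

Lemma im_partE x : im_part x = re_part (- 'i%C *: x).
Proof.
have i2 : (2%:R * 'i%C : R[i])^-1 = 2%:R^-1 * - 'i%C.
  have ii : 'i%C * - 'i%C = 1 :> R[i] by rewrite mulrN -expr2 sqr_i opprK.
  have i0 : 'i%C != 0 :> R[i].
    by apply/eqP => i0; move/eqP: ii; rewrite i0 mul0r eq_sym oner_eq0.
  by rewrite invfM; congr (_ * _); apply: (mulfI i0); rewrite mulfV // ii.
rewrite /im_part /re_part Defs.adjZ i2 -scalerA; congr (_ *: _).
have -> : ((- 'i%C : R[i])^*)%C = 'i%C.
  by apply/eqP; rewrite eq_complex /= !oppr0 opprK !eqxx.
by rewrite scalerBr !scaleNr opprK.
Qed.

Fact re_partD x y : re_part (x + y) = re_part x + re_part y.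
Proof. by rewrite /re_part adjD -scalerDr addrACA. Qed.

Fact re_partN x : re_part (- x) = - re_part x.
Proof. by rewrite !re_partE linearN -opprD scalerN. Qed.

Fact re_partZ (r : R) x : re_part (r%:C%C *: x) = r%:C%C *: re_part x.
Proof.
by rewrite /re_part Defs.adjZ conjc_real -scalerDr !scalerA mulrC.
Qed.

Let sqrt2_neq0 : Num.sqrt 2 != 0 :> R.
Proof. by rewrite sqrtr_eq0 -ltNge ltr0n. Qed.

Fact norm_phase : `|phase R| = 1.
Proof.
have s2 : (Num.sqrt 2)^-1 ^+ 2 = 2^-1 :> R by rewrite exprVn sqr_sqrtr.
rewrite normc_def /= sqrrN s2; have -> : 2^-1 + 2^-1 = 1 :> R by lra.
by rewrite sqrtr1.
Qed.

Fact norm_phaseC : `|((phase R)^*)%C| = 1.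
Proof. by rewrite normcJ norm_phase. Qed.

Lemma rnorm_re_add_im x :
  rnorm (re_part x + im_part x) = Num.sqrt 2 * rnorm (re_part (phase R *: x)).
Proof.
rewrite im_partE -re_partD.
have -> : x + - 'i%C *: x = (Num.sqrt 2)%:C%C *: (phase R *: x).
  rewrite scalerA -{1}[x]scale1r -scalerDl; congr (_ *: _).
  by apply/eqP; rewrite eq_complex /=; apply/andP; split; apply/eqP; field.
by rewrite re_partZ nrm_cscale rnorm_real ger0_norm // sqrtr_ge0.
Qed.

Lemma rnorm_re_sub_im x :
  rnorm (re_part x - im_part x)
    = Num.sqrt 2 * rnorm (re_part (((phase R)^*)%C *: x)).
Proof.
have -> : re_part x - im_part x = re_part (x + 'i%C *: x).
  by rewrite im_partE scaleNr re_partN opprK re_partD.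
have -> : x + 'i%C *: x = (Num.sqrt 2)%:C%C *: (((phase R)^*)%C *: x).
  rewrite scalerA -{1}[x]scale1r -scalerDl; congr (_ *: _).
  by apply/eqP; rewrite eq_complex /=; apply/andP; split; apply/eqP; field.
by rewrite re_partZ nrm_cscale rnorm_real ger0_norm // sqrtr_ge0.
Qed.

Lemma star_re_part x : star (re_part x) = re_part x.
Proof. by rewrite re_partE linearZ /= linearD /= starK addrC. Qed.

Lemma real_state_re_part phi x : real_state phi -> phi (re_part x) = phi x.
Proof. by move=> phis; rewrite re_partE linearZ linearD /= real_state_star //;
  field. Qed.

Lemma nrm_re_part x : nrm (re_part x) <= nrm x.
Proof.
rewrite re_partE nrmZ gtr0_norm ?invr_gt0 //; have := nrmD x (star x);
  rewrite nrm_star; lra.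
Qed.
End States.

(** * Vector states on the span of xi and a xi *)

Section Compression.
Variables (R : realType) (A : cstarAlgType R).
Local Notation B := (realified A).
Local Notation imu := (imu A).
Variables (phi : {scalar B}) (a : B).
Hypothesis phis : real_state phi.

(** The vector state of [c xi]. As [psi] agrees at [z] and at its real part, the bound reduces to
    self-adjoint elements and [real_state_compress]. *)
Lemma real_state_compression (c : B) : phi (star c * c) = 1 ->
  exists2 psi : {scalar B}, real_state psi & forall z, psi z = phi (star c * z
    * c).
Proof.
move=> c1; have lin : GRing.linear_for *%R (fun z : B => phi (star c * z * c)).
  by move=> r x y; rewrite mulrDr mulrDl -scalerAr -scalerAl linearD scalarZ.
pose m := GRing.isLinear.Build R B R *%R _ lin.
pose psi : {scalar B} := HB.pack (fun z : B => phi (star c * z * c)) m.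
have psiE z : psi z = phi (star c * z * c) by [].
clearbody psi; exists psi => //; split; last by rewrite psiE mulr1.
have psi_star x : psi (star x) = psi x.
  rewrite !psiE -(real_state_star (_ * x * c) phis) !starM starK.
  by rewrite mulrA.
move=> z; have <- : psi (re_part (z : A)) = psi z.
  by rewrite re_partE scalarZ linearD /= psi_star; field.
rewrite psiE; apply: le_trans (nrm_re_part z).
have := real_state_compress c phis (star_re_part z).
by rewrite c1 mulr1.
Qed.

Hypothesis phi_max : phi (star a * a) = nrm a ^+ 2.
Hypothesis re_le : nrm (a + star a) <= nrm a.
Hypothesis im_le : nrm (imu * (a - star a)) <= nrm a.

(* In the GNS representation [pi] of [phi], with cyclic vector [xi]:
   [pi(a)^* xi = 0]. *)
Lemma real_state_mul_star0 x : phi (x * star a) = 0.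
Proof.
rewrite -(starK x); apply: real_state_null => //; rewrite starK.
apply/eqP; rewrite eq_le; apply/andP; split; last first.
  by rewrite -{1}(starK a) real_state_ge0.
have s1 : star (a + star a) = a + star a by rewrite linearD /= starK addrC.
have := phis.1 ((a + star a) ^+ 2); have := phis.1 ((imu * (a - star a)) ^+ 2).
rewrite !nrm_sqr ?star_imuB // => h1 h2.
(* Together with [phi (star a a) = |a|^2] this leaves [phi (a star a) <= 0]. *)
have : phi (2 *: (a * star a + star a * a)) <= nrm a ^+ 2 + nrm a ^+ 2.
  rewrite -star_sqrD linearD /=; apply: lerD.
    by apply: le_trans h2 _; rewrite ler_sqr ?nnegrE ?nrm_ge0.
  by apply: le_trans h1 _; rewrite ler_sqr ?nnegrE ?nrm_ge0.
by rewrite scalarZ linearD /= phi_max; lra.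
Qed.

Lemma real_state_mul0 x : phi (a * x) = 0.
Proof. by rewrite -real_state_star // starM real_state_mul_star0. Qed.

(* In the GNS representation: [pi(a)^* pi(a) xi = |a|^2 xi]. *)
Lemma real_state_eigen x : phi (star a * a * x) = nrm a ^+ 2 * phi x.
Proof.
pose y := star a * a - nrm a ^+ 2 *: 1.
have ys : star y = y by rewrite linearB /= linearZ /= star1 starM starK.
suff : phi (star x * y) = 0.
  rewrite -real_state_star // starM ys !starK /y mulrBl -scalerAl mul1r linearB
    scalarZ /=.
  by move/eqP; rewrite subr_eq0 => /eqP.
apply: real_state_null => //; apply/eqP;
  rewrite eq_le real_state_ge0 // andbT ys.
(* Since [phi ((star a a)^2) <= |a|^4], [phi (y^2) <= |a|^4 - 2 |a|^4 + |a|^4 = 0]. *)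
have -> : y * y = (star a * a) ^+ 2 - nrm a ^+ 2 *: (star a * a)
    - nrm a ^+ 2 *: (star a * a) + (nrm a ^+ 2) ^+ 2 *: 1.
  rewrite /y mulrBr !mulrBl -!(@scalerAl _ B) -!(@scalerAr _ B) mulr1 !mul1r
    scalerA.
  by rewrite opprB addrA -!expr2 addrAC.
have := phis.1 ((star a * a) ^+ 2); rewrite nrm_sqr ?starM ?starK // nrm_starM.
by rewrite linearD !(raddfB phi) /= !scalarZ phi_max phis.2; nra.
Qed.

(** Here [c = alpha + t a] with [alpha = p + i q]. In the last two values the scalar part of
    [star c] moves past [a] and vanishes by [real_state_mul0]; [real_state_eigen] evaluates the
    rest. [complexify] assembles them to [t |a|^2 alpha]. *)
Lemma compression_value (p q t : R) (c := p *: 1 + q *: imu + t *: a) :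
  p ^+ 2 + q ^+ 2 + t ^+ 2 * nrm a ^+ 2 = 1 ->
  [/\ phi (star c * c) = 1, phi (star c * a * c) = t * nrm a ^+ 2 * p &
      phi (star c * (imu * a) * c) = - (t * nrm a ^+ 2 * q)].
Proof.
move=> pqt.
have phi_imu : phi imu = 0 by rewrite -[imu]mulr1 real_state_imu // star1.
have phi_a : phi a = 0 by rewrite -[a]mulr1 real_state_mul0.
have phi_c : phi c = p.
  by rewrite !linearD /= !scalarZ phis.2 phi_imu phi_a; ring.
have phi_ic : phi (imu * c) = - q.
  rewrite !mulrDr -!(@scalerAr _ B) imu_sqr mulr1 -imuC !linearD /= !scalarZ.
  by rewrite phi_imu linearN /= phis.2 real_state_mul0; ring.
have cs : star c = (p *: 1 - q *: imu) + t *: star a.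
  by rewrite !linearD /= !linearZ /= star1 star_imu scalerN.
have central x : (p *: 1 - q *: imu) * (a * x) = a * ((p *: 1 - q *: imu) * x).
  by rewrite !mulrBl mulrBr -!(@scalerAl _ B) !mul1r -!(@scalerAr _ B) imuCA.
split.
- rewrite cs mulrDl linearD /= mulrBl -!(@scalerAl _ B) mul1r linearB /=
  !scalarZ phi_c phi_ic.
  rewrite mulrDr mulrDr -!(@scalerAr _ B) !linearD /= !scalarZ mulr1 imuC
    real_state_mul_star0.
  by rewrite -(mul1r (star a)) real_state_mul_star0 mul1r phi_max; nra.
- rewrite -mulrA cs mulrDl linearD /= central real_state_mul0 add0r
    -(@scalerAl _ B) scalarZ.
  by rewrite (mulrA (star a)) real_state_eigen phi_c; ring.
- rewrite -mulrA -(mulrA imu) -(imuCA a) cs mulrDl linearD /= central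
  real_state_mul0 add0r.
  rewrite -(@scalerAl _ B) scalarZ.
  by rewrite (mulrA (star a)) real_state_eigen phi_ic; ring.
Qed.

End Compression.

(** * The numerical range *)

(** With [u = t^2 n^2] the equation is [u^2 - u + (r / n)^2 = 0], whose discriminant [d] is
    nonnegative because [r <= n / 2]. The larger root stays positive even at [r = 0]. *)
Lemma disk_parameters (R : realType) (n r : R) :
  0 < n -> 0 <= r -> r <= n / 2 ->
  exists2 t : R, 0 < t & (r / (t * n ^+ 2)) ^+ 2 + t ^+ 2 * n ^+ 2 = 1.
Proof.
move=> n0 r0 rn.
pose d := 1 - 4 * (r / n) ^+ 2.
have rn2 : 0 <= r / n <= 1 / 2.
  by rewrite divr_ge0 ?(ltW n0) //= ler_pdivrMr //; lra.
have d0 : 0 <= d by rewrite /d; case/andP: rn2; nra.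
pose u := (1 + Num.sqrt d) / 2.
have u0 : 0 < u by have := sqrtr_ge0 d; rewrite /u; lra.
have uE : u ^+ 2 - u + (r / n) ^+ 2 = 0.
  have := sqr_sqrtr d0; rewrite /u {2}/d; nra.
have st : Num.sqrt u ^+ 2 = u by rewrite sqr_sqrtr // ltW.
have su0 : 0 < Num.sqrt u by rewrite sqrtr_gt0.
exists (Num.sqrt u / n); first by rewrite divr_gt0.
have -> : (r / (Num.sqrt u / n * n ^+ 2)) ^+ 2 + (Num.sqrt u / n) ^+ 2 * n ^+ 2
    = (r / n) ^+ 2 / (Num.sqrt u ^+ 2) + Num.sqrt u ^+ 2.
  by field; rewrite !gt_eqF.
rewrite st; have -> : (r / n) ^+ 2 = u * (1 - u) by rewrite expr2 in uE *; lra.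
by rewrite mulrAC mulfV ?gt_eqF // mul1r subrK.
Qed.

Section NumericalRange.
Variables (R : realType) (A : cstarAlgType R).
Local Notation B := (realified A).
Variable a : A.

Lemma rnorm_sqr (p q : R) : rnorm (p +i* q)%C ^+ 2 = p ^+ 2 + q ^+ 2.
Proof. by rewrite /rnorm normc_def /= sqr_sqrtr // addr_ge0 ?sqr_ge0. Qed.

Fact norm_i : `|'i%C : R[i]| = 1.
Proof. by rewrite normc_def /= expr0n expr1n add0r sqrtr1. Qed.

Lemma states_nonempty : exists f : {linear A -> R[i]^o}, states f.
Proof.
have [phi phis _] := real_state_norming (star1 A).
by have [f fs _] := state_of_real_state phis; exists f.
Qed.

Lemma re_part_le_numerical_radius (w : R[i]) : `|w| = 1 ->
  rnorm (re_part (w *: a)) <= numerical_radius a.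
Proof.
move=> w1; have [phi phis phih] := real_state_norming (star_re_part (w *: a)).
have [f fs fE] := state_of_real_state phis.
apply: le_trans (numerical_radius_ub a fs).
have <- : rnorm (w * f a) = rnorm (f a) by rewrite rnormM rnorm_unit // mul1r.
have -> : w * f a = f (w *: a) by rewrite linearZ.
have Ref : complex.Re (f (w *: a)) = phi (re_part (w *: a)).
  by rewrite fE /= real_state_re_part.
rewrite -[leLHS]/(nrm (re_part (w *: a))).
case: phih => e; first by rewrite -e -Ref Re_le_rnorm.
have -> : rnorm (f (w *: a)) = rnorm (- f (w *: a)) by rewrite /rnorm normrN.
apply: le_trans (Re_le_rnorm _); rewrite raddfN /= Ref e opprK; exact: lexx.
Qed.

Lemma rnorm_le_re_im (x : A) : rnorm x <= rnorm (re_part x) + rnorm (im_part x).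
Proof.
have {1}-> : x = re_part x + 'i%C *: im_part x.
  have i0 : 'i%C != 0 :> R[i] by rewrite -normr_eq0 norm_i oner_eq0.
  rewrite /re_part /im_part scalerA invfM mulrCA mulfV // mulr1 -scalerDr.
  have -> : x + adj x + (x - adj x) = 2%:R *: x.
    by rewrite addrACA subrr addr0 scaler_nat mulr2n.
  by rewrite scalerA mulVf ?pnatr_eq0 // scale1r.
apply: le_trans (nrmD (re_part x : B) ('i%C *: im_part x)) _.
by rewrite -imuE nrm_imu.
Qed.

Hypothesis re_norm : forall w : R[i],
  `|w| = 1 -> rnorm (re_part (w *: a)) = rnorm a / 2.

Lemma numerical_range_sub_disk : numerical_range a `<=` disk (rnorm a / 2).
Proof.
move=> _ [f fs <-]; rewrite /disk /=; apply: rnorm_le_rotate => w w1.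
have [phi phis fE] := real_state_of_state fs.
have w1' : `|w| = 1 by rewrite -rnormE w1.
have -> : w * f a = f (w *: a) by rewrite linearZ.
by rewrite fE /= -(real_state_re_part _ phis) -(re_norm w1') phis.1.
Qed.

Lemma disk_sub_numerical_range : disk (rnorm a / 2) `<=` numerical_range a.
Proof.
move=> z; rewrite /disk /= => zle.
have [a0|a0] := eqVneq (rnorm a) 0.
  have z0 : z = 0.
    apply/eqP; rewrite -normr_le0 -rnormE lecR; apply: le_trans zle _.
    by rewrite a0 mul0r.
  have [f fs] := states_nonempty; exists f => //.
  by rewrite z0 (nrm_eq0 a0) linear0.
have n0 : 0 < rnorm a by rewrite lt0r a0 rnorm_ge0.
have [t t0 tE] := disk_parameters n0 (rnorm_ge0 z) zle.
have ps : star (star (a : B) * a) = star (a : B) * a by rewrite starM starK.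
have [phi phis phiE] := real_state_norming ps.
(* The norming functional could take the value [- |a|^2]; positivity excludes this, as [a] is
   nonzero. *)
have phi_max : phi (star (a : B) * a) = nrm a ^+ 2.
  move: phiE (real_state_ge0 (a : B) phis); rewrite nrm_starM => -[->//|->].
  have : 0 < nrm a ^+ 2 by rewrite exprn_gt0.
  lra.
have half x : nrm x = rnorm a / 2 -> nrm (2 *: x : B) <= nrm a.
  by rewrite nrmZ normr_nat => ->; rewrite mulrC divfK.
have re_le : nrm ((a : B) + star a) <= nrm a.
  have := half _ (re_norm (normr1 _)).
  by rewrite scale1r re_partE scalerA mulfV // scale1r.
have im_le : nrm (imu A * ((a : B) - star a)) <= nrm a.
  have := half _ (re_norm norm_i).
  rewrite re_partE scalerA mulfV // scale1r -imuE starM star_imu mulrN imuC.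
  by rewrite -mulrBr.
have t1 : t * nrm a ^+ 2 != 0 by rewrite gt_eqF // mulr_gt0 // exprn_gt0.
(* [p + i q] is [z / (t |a|^2)], the [alpha] for which the vector state takes the value [z]. *)
pose p := complex.Re z / (t * nrm a ^+ 2);
  pose q := complex.Im z / (t * nrm a ^+ 2).
have pq : p ^+ 2 + q ^+ 2 + t ^+ 2 * nrm a ^+ 2 = 1.
  rewrite -tE; congr (_ + _); rewrite /p /q !expr_div_n -mulrDl; congr (_ / _).
  by rewrite -rnorm_sqr; case: (z).
have [c1 ca cia] := compression_value phis phi_max re_le im_le pq.
have [psi psis psiE] := real_state_compression phis c1.
have [f fs fE] := state_of_real_state psis; exists f => //.
rewrite fE /complexify !psiE ca cia opprK /p /q ![_ * (_ / _)]mulrC !divfK //.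
by case: (z).
Qed.

End NumericalRange.

Theorem proposition2p11 (R : realType) (A : cstarAlgType R) (a : A) :
  [<->
    (* (i) *)
    numerical_radius a = rnorm a / 2;
    (* (ii) *)
    forall lambda : R[i], `|lambda| = 1 ->
      rnorm (re_part (lambda *: a)) = rnorm a / 2 /\
      rnorm (im_part (lambda *: a)) = rnorm a / 2;
    (* (iii) *)
    forall lambda : R[i], `|lambda| = 1 ->
      rnorm (re_part (lambda *: a) + im_part (lambda *: a))
        = rnorm a / Num.sqrt 2 /\
      rnorm (re_part (lambda *: a) - im_part (lambda *: a))
        = rnorm a / Num.sqrt 2;
    (* (iv) *)
    exists theta : R,
      semidisk (rnorm a / 2) theta `<=` numerical_range a /\
      numerical_range a `<=` disk (rnorm a / 2)].
Proof.
have s2 : Num.sqrt 2 != 0 :> R by rewrite sqrtr_eq0 -ltNge ltr0n.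
have sq2 : Num.sqrt 2 * (rnorm a / 2) = rnorm a / Num.sqrt 2.
  apply: (mulfI s2); rewrite mulrA -expr2 sqr_sqrtr // [RHS]mulrCA mulfV //
    mulr1.
  by rewrite mulrCA mulfV ?mulr1.
tfae.
- move=> vk w w1.
  have le v : `|v| = 1 -> rnorm (re_part (v *: a)) <= rnorm a / 2.
    by move=> v1; rewrite -vk re_part_le_numerical_radius.
  (* Both parts have norm at most [|a| / 2] and the norms sum to at least [|a|], so equality holds
     in both. *)
  have := rnorm_le_re_im (w *: a); rewrite nrm_cscale (rnorm_unit w1) mul1r.
  have := le w w1; rewrite im_partE scalerA.
  have := le (- 'i%C * w); rewrite normrM w1 mulr1 normrN norm_i => /(_ erefl);
    lra.
- move=> H w w1.
  rewrite rnorm_re_add_im rnorm_re_sub_im !scalerA.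
  have [|-> _] := H (phase R * w).
    by rewrite normrM w1 norm_phase mulr1.
  have [|-> _] := H (((phase R)^*)%C * w).
    by rewrite normrM w1 norm_phaseC mulr1.
  by rewrite sq2.
(* The range is the whole disk, so the choice of half is arbitrary. *)
- move=> H; exists 0.
  have re_norm w : `|w| = 1 -> rnorm (re_part (w *: a)) = rnorm a / 2.
    move=> w1; have o0 : phase R != 0 by rewrite -normr_eq0 norm_phase oner_eq0.
    have [|+ _] := H ((phase R)^-1 * w);
      first by rewrite normrM normfV norm_phase invr1 mul1r.
    rewrite rnorm_re_add_im scalerA mulrA mulfV // mul1r -sq2.
    by move/(mulfI s2).
  split; last exact: numerical_range_sub_disk.
  by move=> z [zk _]; exact: disk_sub_numerical_range.
- move=> [theta [sub1 sub2]].
  have k0 : 0 <= rnorm a / 2 by rewrite divr_ge0 // rnorm_ge0.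
  set k := rnorm a / 2 in k0 sub1 sub2 *.
  clearbody k.
  (* [z = k e^(-i theta)] lies on the rim of the half disk, as [e^(i theta) z = k]; a state reaching
     it gives [v(a) >= k]. *)
  pose z : R[i] := (k * cos theta -i* (k * sin theta))%C.
  have zk : rnorm z = k.
    rewrite /rnorm normc_def /= sqrrN !exprMn -mulrDr cos2Dsin2 mulr1 sqrtr_sqr.
    by rewrite ger0_norm.
  have [|f fs fz] := sub1 z.
    split; first by rewrite zk.
    rewrite /= mulrN opprK mulrCA (mulrCA (sin _)) -mulrDr -!expr2 cos2Dsin2
      mulr1.
    exact: k0.
  apply/eqP; rewrite eq_le; apply/andP; split.
    apply: ge_sup; first by exists (rnorm (f a)), f.
    by move=> _ [g gs <-]; apply: sub2; exists g.
  by rewrite -zk -fz numerical_radius_ub.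
Qed.
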